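(* For every $\mathbf{x}=(x_1,\dots,x_N)\in\mathrm{St}(d,r)^N$, $$\tfrac12\|\mathbf{x}-\bar{\mathbf{x}}\|_F^2\le\|\mathbf{x}-\hat{\mathbf{x}}\|_F^2\le\|\mathbf{x}-\bar{\mathbf{x}}\|_F^2.$$ Moreover, if $\|\mathbf{x}-\bar{\mathbf{x}}\|_F^2\le N/2$, then $$\|\bar x-\hat x\|_F\le\frac{2\sqrt r\,\|\mathbf{x}-\bar{\mathbf{x}}\|_F^2}{N}$$ and $$\|\mathbf{x}-\hat{\mathbf{x}}\|_F^2\ge\|\mathbf{x}-\bar{\mathbf{x}}\|_F^2-\frac{4r\,\|\mathbf{x}-\bar{\mathbf{x}}\|_F^4}{N}.$$
   Context: Let $1\le r\le d$ and $N\ge1$ be integers and $\mathrm{St}(d,r)=\{x\in\mathbb{R}^{d\times r}:x^\top x=I_r\}$. $\|\cdot\|_F$ is the Frobenius norm, applied also to stacked tuples $\mathbf{x}=(x_1,\dots,x_N)$. The Euclidean mean is $\hat x=\frac1N\sum_{i=1}^Nx_i$ and $\hat{\mathbf{x}}=(\hat x,\dots,\hat x)$ ($N$ copies). The induced arithmetic mean (IAM) $\bar x$ is a minimizer of $\sum_{i=1}^N\|y-x_i\|_F^2$ over $y\in\mathrm{St}(d,r)$, i.e. an orthogonal projection of $\hat x$ onto $\mathrm{St}(d,r)$, and $\bar{\mathbf{x}}=(\bar x,\dots,\bar x)$. *)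

(* Defs.v *)
From HB Require Import structures.
From mathcomp Require Import all_boot all_order all_algebra.
From mathcomp Require Import reals.

Set Implicit Arguments.
Unset Strict Implicit.
Unset Printing Implicit Defensive.

Import Order.TTheory GRing.Theory Num.Theory.
Local Open Scope ring_scope.

Definition Stiefel (R : realType) (d r : nat) : {pred 'M[R]_(d, r)} :=
  [pred x : 'M[R]_(d, r) | x^T *m x == 1%:M].
Arguments Stiefel {R} d r.

Definition frob_norm (R : realType) (d r : nat) (A : 'M[R]_(d, r)) : R :=
  Num.sqrt (\sum_(i < d) \sum_(j < r) A i j ^+ 2).

(* Frobenius norm of the Nd x r matrix obtained by stacking the N blocks. *)
Definition stack_norm (R : realType) (N d r : nat)
    (x : {ffun 'I_N -> 'M[R]_(d, r)}) : R :=
  Num.sqrt (\sum_(k < N) \sum_(i < d) \sum_(j < r) x k i j ^+ 2).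

(* The tuple (y, ..., y) of N copies; N is found from the expected type. *)
Definition copies (R : realType) (N d r : nat) (y : 'M[R]_(d, r)) :
    {ffun 'I_N -> 'M[R]_(d, r)} :=
  [ffun=> y].
Arguments copies {R N d r} y.

Definition euclidean_mean (R : realType) (N d r : nat)
    (x : {ffun 'I_N -> 'M[R]_(d, r)}) : 'M[R]_(d, r) :=
  N%:R^-1 *: \sum_(i < N) x i.

(* Induced arithmetic mean. It need not be unique, hence a predicate on the
   candidate xbar rather than a function of x. *)
Definition is_IAM (R : realType) (N d r : nat)
    (x : {ffun 'I_N -> 'M[R]_(d, r)}) (xbar : 'M[R]_(d, r)) : Prop :=
  xbar \in Stiefel d r /\
  forall y : 'M[R]_(d, r), y \in Stiefel d r ->
    \sum_(i < N) frob_norm (xbar - x i) ^+ 2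
      <= \sum_(i < N) frob_norm (y - x i) ^+ 2.

(* Main.v *)
(** Write [D] and [V] for the squared distances of the tuple to [xbar] and to
    [xhat]; then [D - V = N |xbar - xhat|^2]. Each [x k] is itself a competitor
    of [xbar], so [<x k, xhat> <= <xbar, xhat>]; averaging over [k] gives
    [|xhat|^2 <= <xbar, xhat>], which is [D / 2 <= V].
    Comparing [xbar] with its images under plane rotations shows that
    [xhat *m xbar^T] is symmetric, so [xhat = xbar *m H] where
    [H := xbar^T *m xhat] is symmetric. Expanding [e_k := x k - xbar] then yields
    [2 N (1 - H) = \sum_k e_k^T *m e_k], and submultiplicativity of the
    Frobenius norm gives [|xbar - xhat| = |1 - H| <= D / (2 N)]; no singular value
    decomposition is needed. *)
Require Import Defs.
From HB Require Import structures.
From mathcomp Require Import all_boot all_order all_algebra.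
From mathcomp Require Import reals.
From mathcomp Require Import ring lra.
Import Order.TTheory GRing.Theory Num.Theory.
Local Open Scope ring_scope.

(** * Frobenius inner products as traces, and norm inequalities *)

Lemma tr_mulTmx (K : comPzRingType) (m n : nat) (A B : 'M[K]_(m, n)) :
  \tr (A^T *m B) = \sum_i \sum_j A i j * B i j.
Proof.
rewrite exchange_big; apply: eq_bigr => j _.
by rewrite !mxE; apply: eq_bigr => i _; rewrite !mxE.
Qed.

Lemma tr_mulTmxC (K : comPzRingType) (m n : nat) (A B : 'M[K]_(m, n)) :
  \tr (A^T *m B) = \tr (B^T *m A).
Proof. by rewrite -mxtrace_tr trmx_mul trmxK. Qed.

Lemma tr_mulTmx_ge0 (K : realDomainType) (m n : nat) (A : 'M[K]_(m, n)) :
  0 <= \tr (A^T *m A).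
Proof.
rewrite tr_mulTmx; apply: sumr_ge0 => i _; apply: sumr_ge0 => j _.
by rewrite -expr2 sqr_ge0.
Qed.

Lemma sqr_frob_norm (R : realType) (d r : nat) (A : 'M[R]_(d, r)) :
  frob_norm A ^+ 2 = \tr (A^T *m A).
Proof.
rewrite /frob_norm sqr_sqrtr; last first.
  by apply: sumr_ge0 => i _; apply: sumr_ge0 => j _; rewrite sqr_ge0.
rewrite tr_mulTmx; apply: eq_bigr => i _; apply: eq_bigr => j _.
by rewrite expr2.
Qed.

Lemma sqr_stack_norm (R : realType) (N d r : nat)
    (x : {ffun 'I_N -> 'M[R]_(d, r)}) :
  stack_norm x ^+ 2 = \sum_k \tr ((x k)^T *m x k).
Proof.
rewrite /stack_norm sqr_sqrtr; last first.
  apply: sumr_ge0 => k _; apply: sumr_ge0 => i _; apply: sumr_ge0 => j _.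
  by rewrite sqr_ge0.
apply: eq_bigr => k _; rewrite tr_mulTmx.
by apply: eq_bigr => i _; apply: eq_bigr => j _; rewrite expr2.
Qed.

Lemma sum_cauchy_schwarz (K : realDomainType) (I : finType) (f g : I -> K) :
  (\sum_i f i * g i) ^+ 2 <= (\sum_i f i ^+ 2) * (\sum_i g i ^+ 2).
Proof.
(* Lagrange's identity *)
have : 0 <= \sum_i \sum_j (f i * g j - f j * g i) ^+ 2.
  by apply: sumr_ge0 => i _; apply: sumr_ge0 => j _; rewrite sqr_ge0.
have -> : \sum_i \sum_j (f i * g j - f j * g i) ^+ 2 =
    (\sum_i f i ^+ 2) * (\sum_i g i ^+ 2)
    + (\sum_i g i ^+ 2) * (\sum_i f i ^+ 2)
    - 2 * ((\sum_i f i * g i) * (\sum_i f i * g i)).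
  rewrite !big_distrlr /= mulr_sumr -big_split -sumrB; apply: eq_bigr => i _.
  rewrite mulr_sumr -big_split -sumrB; apply: eq_bigr => j _ /=.
  by ring.
by rewrite expr2; lra.
Qed.

(** Submultiplicativity of the Frobenius norm: each entry of [A *m B^T] is an inner product of a row
    of [A] with a row of [B], so Cauchy-Schwarz applies entrywise. *)
Lemma tr_mulmxT_le (K : realDomainType) (m n p : nat)
    (A : 'M[K]_(m, p)) (B : 'M[K]_(n, p)) :
  \tr ((A *m B^T)^T *m (A *m B^T)) <= \tr (A^T *m A) * \tr (B^T *m B).
Proof.
rewrite !tr_mulTmx big_distrlr /=.
apply: ler_sum => i _; apply: ler_sum => j _.
have := sum_cauchy_schwarz _ _ (A i) (B j).
rewrite -expr2 !mxE; under [\sum_k A i k * B^T k j]eq_bigr do rewrite mxE.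
by under [\sum_i0 A i i0 ^+ 2]eq_bigr do rewrite expr2;
  under [\sum_i0 B j i0 ^+ 2]eq_bigr do rewrite expr2.
Qed.

(** Both sides expand over pairs [(k, l)]; by cyclicity of the trace the left term is the squared
    Frobenius norm of [e k *m (e l)^T], to which submultiplicativity applies. *)
Lemma tr_sqr_sum_gram_le (K : realDomainType) (N m n : nat)
    (e : 'I_N -> 'M[K]_(m, n)) (S := \sum_k (e k)^T *m e k) :
  \tr (S *m S) <= \tr S ^+ 2.
Proof.
rewrite /S expr2 mulmx_suml !raddf_sum big_distrlr /=; apply: ler_sum => k _.
rewrite mulmx_sumr raddf_sum; apply: ler_sum => l _ /=.
have := tr_mulmxT_le _ _ _ _ (e k) (e l); congr (_ <= _).
by rewrite trmx_mul trmxK -[e l *m _ *m _]mulmxA mxtrace_mulC !mulmxA.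
Qed.

(** * First-order optimality under plane rotations *)

Lemma linear_le_quadratic_eq0 (K : realFieldType) (a b : K) :
  (forall t, t * b <= t ^+ 2 * a) -> b = 0.
Proof.
move=> h; have p0 : 0 < 1 + a ^+ 2 by nra.
(* The denominator [1 + a ^+ 2] is positive and exceeds [a] whatever the sign of [a], so [1 - q * a]
   is positive. *)
have := h (b / (1 + a ^+ 2)); set q := _^-1 => hq.
have q1 : q * (1 + a ^+ 2) = 1 by rewrite mulVf // gt_eqF.
have q0 : 0 < q by rewrite invr_gt0.
have {}hq : b ^+ 2 * q * (1 - q * a) <= 0 by nra.
have hp : 0 < q * (1 - q * a).
  rewrite mulr_gt0 // -q1 -mulrBr mulr_gt0 //; nra.
apply/eqP; rewrite -sqrf_eq0 eq_le sqr_ge0 andbT.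
by rewrite -(pmulr_lle0 _ hp); nra.
Qed.

Lemma trmx_rotation (K : comPzRingType) (n : nat) (A : 'M[K]_n) (c s : K) :
  A^T = - A ->
  (1%:M + s *: A + (1 - c) *: (A *m A))^T
    = 1%:M - s *: A + (1 - c) *: (A *m A).
Proof.
move=> AT; rewrite !linearD /= !linearZ /= trmx1 trmx_mul AT.
by rewrite mulNmx mulmxN opprK scalerN.
Qed.

(* Rodrigues' rotation formula *)
Lemma rotation_orthogonal (K : comPzRingType) (n : nat) (A : 'M[K]_n)
    (c s : K) (Q := 1%:M + s *: A + (1 - c) *: (A *m A)) :
  A^T = - A -> A *m A *m A = - A -> c ^+ 2 + s ^+ 2 = 1 -> Q^T *m Q = 1%:M.
Proof.
move=> AT A3 cs.
rewrite /Q trmx_rotation // !mulmxDl !mulmxDr !mul1mx !mulNmx !mulmx1.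
rewrite -!scalemxAl -!scalemxAr !mulmxA !A3 mulNmx.
apply/matrixP => i j; rewrite !mxE.
set a := A i j; set b := \sum_k _.
(* Since [A ^ 3 = - A], the odd powers cancel in the product; this is the remaining coefficient of
   [A *m A], equal to [1 - c ^+ 2 - s ^+ 2]. *)
suff : (1 - c) * 2 - s ^+ 2 - (1 - c) ^+ 2 = 0.
  by move=> h; transitivity ((i == j)%:R
    + b * ((1 - c) * 2 - s ^+ 2 - (1 - c) ^+ 2)); [ring | rewrite h; ring].
by rewrite -[s ^+ 2](addKr (c ^+ 2)) cs; ring.
Qed.

(** Rotating in the plane of coordinates [i] and [j] changes the trace, to first order, by a
    multiple of [M j i - M i j], which must vanish at a maximum. *)
Lemma orthogonal_tr_max_sym (K : realFieldType) (n : nat) (M : 'M[K]_n) :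
  (forall Q : 'M_n, Q^T *m Q = 1%:M -> \tr (Q^T *m M) <= \tr M) -> M^T = M.
Proof.
move=> maxM; apply/matrixP => i j; rewrite mxE.
have [->//|neq_ij] := eqVneq i j.
(* The generator of the rotations in that plane; [- (A *m A)] is the projection onto the plane,
   whence [A ^ 3 = - A]. *)
pose A : 'M[K]_n := delta_mx i j - delta_mx j i.
have AT : A^T = - A by rewrite /A linearB /= !trmx_delta opprB.
have A2 : A *m A = - (delta_mx i i + delta_mx j j).
  rewrite /A mulmxBl !mulmxBr !mul_delta_mx_cond !eqxx (negPf neq_ij).
  by rewrite eq_sym (negPf neq_ij) !mulr0n !mulr1n sub0r subr0 opprD.
have A3 : A *m A *m A = - A.
  rewrite A2 /A mulNmx mulmxDl !mulmxBr !mul_delta_mx_cond !eqxx.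
  rewrite [j == i]eq_sym (negPf neq_ij) !mulr0n !mulr1n.
  by rewrite sub0r subr0.
apply/eqP; rewrite -subr_eq0; apply/eqP.
apply: (@linear_le_quadratic_eq0 K (- \tr (A *m A *m M))) => t.
have p0 : 0 < 1 + t ^+ 2 by rewrite ltr_pwDl ?sqr_ge0.
have pn0 : 1 + t ^+ 2 != 0 by rewrite gt_eqF.
(* The rational parametrization of the circle makes sense in any real field, and gives [1 - c] a
   factor [t ^+ 2]. *)
pose c := (1 - t ^+ 2) / (1 + t ^+ 2); pose s := - (2 * t / (1 + t ^+ 2)).
have cs : c ^+ 2 + s ^+ 2 = 1 by rewrite /c /s; field.
have := maxM _ (rotation_orthogonal _ _ A c s AT A3 cs).
have tr_delta (k l : 'I_n) : \tr (delta_mx k l *m M) = M l k.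
  rewrite -[delta_mx k l]trmxK trmx_delta tr_mulTmx.
  rewrite (bigD1 l) //= (bigD1 k) //= !mxE !eqxx mul1r.
  rewrite !big1 ?addr0 // => [l' nl|k' nk].
    by rewrite big1 // => k' _; rewrite mxE (negPf nl) mul0r.
  by rewrite mxE (negPf nk) andbF mul0r.
have trA : \tr (A *m M) = M j i - M i j.
  by rewrite /A mulmxBl linearB /= !tr_delta.
clearbody A; rewrite trmx_rotation //.
rewrite !mulmxDl mul1mx mulNmx -!scalemxAl !mxtraceD mxtraceZ linearN /= mxtraceZ trA.
move: (\tr (A *m A *m M)) (\tr M) => w z.
rewrite /c /s => h.
have {}h : (2 * t * (M j i - M i j) + 2 * t ^+ 2 * w) / (1 + t ^+ 2) <= 0.
  move: h; rewrite -addrA -[leRHS]addr0 lerD2l => h.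
  by apply: le_trans h; rewrite le_eqVlt; apply/orP; left; apply/eqP; field.
by move: h; rewrite pmulr_lle0 ?invr_gt0 //; lra.
Qed.

(** * The induced arithmetic mean *)

Lemma sum_tr_sub (R : realType) (N d r : nat)
    (x : {ffun 'I_N -> 'M[R]_(d, r)}) (y : 'M[R]_(d, r)) : (0 < N)%N ->
  \sum_k \tr ((x k - y)^T *m (x k - y)) =
  \sum_k \tr ((x k)^T *m x k)
  + N%:R * (\tr (y^T *m y) - 2 * \tr (y^T *m euclidean_mean x)).
Proof.
move=> N0; have Nn0 : N%:R != 0 :> R by rewrite pnatr_eq0 -lt0n.
have -> : \tr (y^T *m euclidean_mean x) = N%:R^-1 * \sum_k \tr (y^T *m x k).
  by rewrite /euclidean_mean -scalemxAr mxtraceZ mulmx_sumr raddf_sum.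
have -> : N%:R * (\tr (y^T *m y) - 2 * (N%:R^-1 * \sum_k \tr (y^T *m x k))) =
    \sum_(k < N) (\tr (y^T *m y) - 2 * \tr (y^T *m x k)).
  rewrite sumrB sumr_const card_ord -mulr_sumr -mulr_natl.
  by field.
rewrite -big_split; apply: eq_bigr => k _ /=.
rewrite [(_ - _)^T]linearB /= mulmxBl !mulmxBr !raddfB /= [\tr ((x k)^T *m y)]tr_mulTmxC.
by ring.
Qed.

(** All Stiefel points have squared norm [r], so minimizing the sum of squares amounts to maximizing
    the inner product with the Euclidean mean. *)
Lemma IAM_tr_max (R : realType) (N d r : nat)
    (x : {ffun 'I_N -> 'M[R]_(d, r)}) (xbar y : 'M[R]_(d, r)) :
  (0 < N)%N -> is_IAM x xbar -> y \in Stiefel d r ->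
  \tr (y^T *m euclidean_mean x) <= \tr (xbar^T *m euclidean_mean x).
Proof.
move=> N0 [/eqP xbarS min_xbar] yS; have := min_xbar y yS.
have sumE z : \sum_(i < N) frob_norm (z - x i) ^+ 2
    = \sum_k \tr ((x k - z)^T *m (x k - z)).
  apply: eq_bigr => k _; rewrite sqr_frob_norm -[z - x k]opprB [(- _)^T]linearN /=.
  by rewrite mulNmx mulmxN opprK.
have {yS}/eqP yS := yS.
rewrite !sumE !sum_tr_sub // xbarS yS lerD2l ler_pM2l ?ltr0n //; lra.
Qed.

(** A polar-type factorization of the mean, obtained by testing [xbar] against the competitors
    [Q *m xbar] with [Q] orthogonal. *)
Lemma IAM_polar (R : realType) (N d r : nat)
    (x : {ffun 'I_N -> 'M[R]_(d, r)}) (xbar : 'M[R]_(d, r))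
    (H := xbar^T *m euclidean_mean x) :
  (0 < N)%N -> is_IAM x xbar -> H^T = H /\ euclidean_mean x = xbar *m H.
Proof.
move=> N0 xbarP; have [/eqP xbarS _] := xbarP; rewrite /H {H}.
set xhat := euclidean_mean x.
have symM : (xhat *m xbar^T)^T = xhat *m xbar^T.
  apply: orthogonal_tr_max_sym => Q QQ.
  have QS : Q *m xbar \in Stiefel d r.
    by apply/eqP; rewrite trmx_mul mulmxA -(mulmxA _ Q^T) QQ mulmx1.
  have := IAM_tr_max _ _ _ _ _ _ _ N0 xbarP QS; rewrite -/xhat.
  by rewrite trmx_mul -mulmxA mxtrace_mulC [\tr (xbar^T *m _)]mxtrace_mulC mulmxA.
rewrite trmx_mul trmxK in symM.
(* The symmetry relation is multiplied by [xbar] on the right, where [xbar^T *m xbar] is the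
   identity. *)
have xhatE : xhat = xbar *m (xhat^T *m xbar).
  by rewrite mulmxA symM -mulmxA xbarS mulmx1.
have HT : xbar^T *m xhat = xhat^T *m xbar.
  by rewrite {1}xhatE mulmxA xbarS mul1mx.
by rewrite trmx_mul trmxK HT.
Qed.

Lemma IAM_dist_mean_le (R : realType) (N d r : nat)
    (x : {ffun 'I_N -> 'M[R]_(d, r)}) (xbar : 'M[R]_(d, r)) :
  (0 < N)%N -> (forall i, x i \in Stiefel d r) -> is_IAM x xbar ->
  2 * N%:R * frob_norm (xbar - euclidean_mean x)
    <= stack_norm (x - copies xbar) ^+ 2.
Proof.
move=> N0 xS xbarP; have [/eqP xbarS _] := xbarP.
have [] := IAM_polar _ _ _ _ _ _ N0 xbarP.
set xhat := euclidean_mean x; set H := xbar^T *m xhat => HT xhatE.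
pose S := \sum_k (x k - xbar)^T *m (x k - xbar).
have sumx : \sum_k x k = N%:R *: xhat.
  by rewrite /xhat /euclidean_mean scalerA divff ?scale1r // pnatr_eq0 -lt0n.
have SE : S = (2 * N%:R) *: (1%:M - H).
  transitivity (\sum_(k < N) (1%:M + 1%:M - (x k)^T *m xbar - xbar^T *m x k)).
    apply: eq_bigr => k _; have /eqP xk := xS k.
    rewrite [(_ - _)^T]linearB /= mulmxBl !mulmxBr xk xbarS opprB.
    by rewrite addrACA addrA.
  rewrite !sumrB -mulmx_sumr -mulmx_suml -linear_sum /= sumx.
  rewrite linearZ /= -scalemxAl -scalemxAr -/H.
  have -> : xhat^T *m xbar = H by rewrite -HT trmx_mul trmxK.
  rewrite sumr_const card_ord -addrA -opprD -scalerDl scalerBr.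
  rewrite -[N%:R + _]mulr2n -[N%:R *+ 2]mulr_natl -[1%:M + _]mulr2n -mulrnA.
  by rewrite -[1%:M *+ _]scaler_nat natrM.
have trS : stack_norm (x - copies xbar) ^+ 2 = \tr S.
  by rewrite sqr_stack_norm raddf_sum; apply: eq_bigr => k _; rewrite !ffunE.
(* Here [xbar - xhat = xbar *m (1%:M - H)], and left multiplication by [xbar] preserves the
   Frobenius norm. *)
have normE : frob_norm (xbar - xhat) ^+ 2 = \tr ((1%:M - H) *m (1%:M - H)).
  rewrite sqr_frob_norm {1 2}xhatE -{1 3}[xbar]mulmx1 -mulmxBr trmx_mul.
  by rewrite mulmxA -(mulmxA _ xbar^T) xbarS mulmx1 [(_ - _)^T]linearB /= trmx1 HT.
have S0 : 0 <= \tr S by rewrite -trS sqr_ge0.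
rewrite trS -(@ler_pXn2r _ 2) ?nnegrE ?mulr_ge0 ?sqrtr_ge0 ?ler0n //.
apply: le_trans (tr_sqr_sum_gram_le _ _ _ _ (fun k => x k - xbar)).
by rewrite -/S SE -scalemxAl -scalemxAr !mxtraceZ -normE mulrA -expr2 exprMn.
Qed.

Theorem lemma1 (R : realType) (N d r : nat)
  (hr : (1 <= r)%N) (hrd : (r <= d)%N) (hN : (1 <= N)%N)
  (x : {ffun 'I_N -> 'M[R]_(d, r)})
  (hx : forall i : 'I_N, x i \in Stiefel d r)
  (xbar : 'M[R]_(d, r)) (hxbar : is_IAM x xbar) :
  let xhat := euclidean_mean x in
  (1 / 2 * stack_norm (x - copies xbar) ^+ 2
     <= stack_norm (x - copies xhat) ^+ 2
   /\ stack_norm (x - copies xhat) ^+ 2 <= stack_norm (x - copies xbar) ^+ 2)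
  /\ (stack_norm (x - copies xbar) ^+ 2 <= N%:R / 2 ->
      frob_norm (xbar - xhat)
        <= 2 * Num.sqrt r%:R * stack_norm (x - copies xbar) ^+ 2 / N%:R
      /\ stack_norm (x - copies xhat) ^+ 2
           >= stack_norm (x - copies xbar) ^+ 2
              - 4 * r%:R * stack_norm (x - copies xbar) ^+ 4 / N%:R).
Proof.
move=> xhat; have [/eqP xbarS _] := hxbar.
have N0 : 0 < N%:R :> R by rewrite ltr0n.
have stackE y : stack_norm (x - copies y) ^+ 2 =
    \sum_k \tr ((x k - y)^T *m (x k - y)).
  by rewrite sqr_stack_norm; apply: eq_bigr => k _; rewrite !ffunE.
have sumS : \sum_k \tr ((x k)^T *m x k) = N%:R * r%:R.
  under eq_bigr => k _ do rewrite (eqP (hx k)) mxtrace1.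
  by rewrite sumr_const card_ord mulr_natl.
have xhat_le : \tr (xhat^T *m xhat) <= \tr (xbar^T *m xhat).
  rewrite {1}/xhat /euclidean_mean [(_ *: _)^T]linearZ /= -scalemxAl mxtraceZ.
  rewrite mulrC ler_pdivrMr // linear_sum mulmx_suml raddf_sum /= mulr_natr.
  rewrite -[X in _ *+ X]card_ord -sumr_const; apply: ler_sum => k _.
  exact: IAM_tr_max.
have DE : stack_norm (x - copies xbar) ^+ 2 =
    2 * N%:R * (r%:R - \tr (xbar^T *m xhat)).
  by rewrite stackE sum_tr_sub // sumS xbarS mxtrace1 -/xhat; ring.
have VE : stack_norm (x - copies xhat) ^+ 2 =
    N%:R * (r%:R - \tr (xhat^T *m xhat)).
  by rewrite stackE sum_tr_sub // sumS -/xhat; ring.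
have EE : stack_norm (x - copies xhat) ^+ 2 =
    stack_norm (x - copies xbar) ^+ 2 - N%:R * frob_norm (xbar - xhat) ^+ 2.
  rewrite DE VE sqr_frob_norm [(_ - _)^T]linearB /= mulmxBl !mulmxBr !raddfB /=.
  by rewrite xbarS mxtrace1 [\tr (xhat^T *m xbar)]tr_mulTmxC; ring.
have E0 : 0 <= frob_norm (xbar - xhat) by exact: sqrtr_ge0.
split; first split.
- by rewrite DE VE; nra.
- by rewrite EE; nra.
move=> _; have := IAM_dist_mean_le _ _ _ _ _ _ hN hx hxbar; rewrite -/xhat EE.
rewrite -[4%N]/(2 * 2)%N exprM.
have := sqr_ge0 (stack_norm (x - copies xbar)).
move: (stack_norm _ ^+ 2) (frob_norm _) E0 => D E E0 D0 hE.
have r1 : 1 <= r%:R :> R by rewrite ler1n.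
have s1 : 1 <= Num.sqrt r%:R :> R by rewrite -[leLHS]sqrtr1 ler_sqrt // ltr0n.
split.
  (* From [2 * N%:R * E <= D], as [Num.sqrt r%:R] is at least 1. *)
  rewrite ler_pdivlMr //.
  by nra.
rewrite lerD2l lerN2 ler_pdivlMr //.
(* Squaring bounds the defect [N%:R * E ^+ 2] by [D ^+ 2 / (4 * N%:R)], which is below the required
   bound since [1 <= r%:R]. *)
have : (2 * N%:R * E) ^+ 2 <= D ^+ 2.
  by rewrite ler_pXn2r // nnegrE !mulr_ge0.
by have := sqr_ge0 D; nra.
Qed.
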